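(* Let $d\ge1$. (1) The matrices $\mathcal{F}_d$ and $\mathcal{R}_d$ are similar. (2) The matrices $\mathcal{F}_d$ and $\mathcal{R}_d$ are diagonalizable with eigenvalue $1$ of multiplicity $2$ and eigenvalues $2\cdot2!,\,2^2\cdot3!,\ldots,2^{d-1}\cdot d!$, each of multiplicity $1$.
   Context: All matrices are $(d+1)\times(d+1)$ with rows and columns indexed by $0,\ldots,d$. $\mathcal{F}_d=[b_{k,l}]_{0\le k,l\le d}$ is given by $b_{0,0}=1$, $b_{0,l}=0$ for $l>0$, and, for $1\le k\le d$, $b_{k,l}=\sum_{j=0}^{k-1}(-1)^j\binom{k-1}{j}\big[(2k-2j)^l-(2k-2j-1)^l\big]$. (It is the matrix transforming the $f$-vector of a $(d-1)$-dimensional simplicial complex to that of its interval subdivision.) $\mathcal{H}_d$ is the $f$-vector-to-$h$-vector matrix, with $(i,j)$ entry $(-1)^{i+j}\binom{d-j}{i-j}$, whose inverse has $(i,j)$ entry $\binom{d-j}{i-j}$ (binomial coefficients with negative lower index are $0$). $\mathcal{R}_d=\mathcal{H}_d\mathcal{F}_d\mathcal{H}_d^{-1}$. For $d=1$ the list $2\cdot2!,\ldots,2^{d-1}\cdot d!$ is empty. *)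

(* Defs.v *)
From mathcomp Require Import all_boot all_order all_algebra zify ring.
Set Implicit Arguments.
Unset Strict Implicit.
Unset Printing Implicit Defensive.

Import GRing.Theory Num.Theory.
Local Open Scope ring_scope.

Section Matrices.
Variables (K : numFieldType) (d : nat).

(* Since j < k, the naturals k - 1, 2k - 2j and 2k - 2j - 1 are not truncated. *)
Definition Fmx : 'M[K]_d.+1 :=
  \matrix_(k < d.+1, l < d.+1)
    if k == 0 then (l == 0)%:R
    else \sum_(j < k) (-1) ^+ j * 'C(k.-1, j)%:R *
           ((2 * k - 2 * j)%:R ^+ l - (2 * k - 2 * j - 1)%:R ^+ l).

(* The guard j <= i encodes the convention that binomials with negative lower  *)
(* index vanish: in nat, i - j would be truncated to 0.                        *)
Definition Hmx : 'M[K]_d.+1 :=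
  \matrix_(i < d.+1, j < d.+1)
    if (j <= i)%N then (-1) ^+ (i + j) * 'C(d - j, i - j)%:R else 0.

Definition Hmx_inv : 'M[K]_d.+1 :=
  \matrix_(i < d.+1, j < d.+1)
    if (j <= i)%N then 'C(d - j, i - j)%:R else 0.

Definition Rmx : 'M[K]_d.+1 := Hmx *m Fmx *m invmx Hmx.

End Matrices.

(* For a diagonalizable matrix the algebraic and geometric multiplicities      *)
(* agree; both are required to be m.                                           *)
Definition has_multiplicity (K : fieldType) (n : nat) (A : 'M[K]_n) (a : K)
    (m : nat) : Prop :=
  mup a (char_poly A) = m /\ \rank (eigenspace A a) = m.

Lemma bin_trinomial (n s t : nat) : (t <= s <= n)%N ->
  ('C(n, t) * 'C(n - t, s - t) = 'C(n, s) * 'C(s, t))%N.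
Proof.
move=> /andP[ts sn]; have tn := leq_trans ts sn.
have f0 : (0 < t`! * (s - t)`! * (n - s)`!)%N by rewrite !muln_gt0 !fact_gt0.
apply/eqP; rewrite -(eqn_pmul2r f0); apply/eqP.
have e1 := bin_fact tn; have e2 := bin_fact sn; have e3 := bin_fact ts.
have le4 : (s - t <= n - t)%N by rewrite leq_sub2r.
have e4 := bin_fact le4; rewrite subnBA // subnK // in e4.
transitivity (n`!)%N; first by rewrite -[RHS]e1 -e4 mulnACA !mulnA; nia.
by rewrite -e2 -e3; nia.
Qed.

Lemma Hmx_mul_inv (K : numFieldType) (d : nat) : Hmx K d *m Hmx_inv K d = 1%:M.
Proof.
apply/matrixP=> i j; rewrite !mxE.
have [ltij | leji] := ltnP i j.
  rewrite big1 ?(negPf _) //; first by rewrite -val_eqE /= ltn_eqF.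
  move=> k _; rewrite !mxE; case: leqP => [ki | _]; last by rewrite mul0r.
  by rewrite leqNgt (leq_ltn_trans ki ltij) mulr0.
have i_d : (i <= d)%N by rewrite -ltnS.
transitivity (\sum_(k < d.+1 | (j <= k <= i)%N)
   (-1) ^+ (i + k) * ('C(d - j, i - j) * 'C(i - j, k - j))%:R : K).
  rewrite [RHS]big_mkcond /=; apply: eq_bigr => k _; rewrite !mxE.
  case: (leqP j k) => jk /=; last by rewrite mulr0.
  case: (leqP k i) => ki; last by rewrite mul0r.
  have h : (k - j <= i - j <= d - j)%N by rewrite !leq_sub2r.
  rewrite -mulrA -natrM -(bin_trinomial h) mulnC.
  by congr (_ * ('C(_, _) * 'C(_, _))%:R); lia.
rewrite (eq_bigl (fun k : 'I_d.+1 => (true && (k < i.+1)%N) && (j <= k)%N));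
  last by move=> k; rewrite /= ltnS andbC.
rewrite -(big_mkord (fun k => (true && (k < i.+1)%N) && (j <= k)%N)
  (fun k => (-1) ^+ (i + k) * ('C(d - j, i - j) * 'C(i - j, k - j))%:R)).
rewrite -(big_nat_widenl _ _ _ (fun k => true && (k < i.+1)%N)) //.
rewrite -(big_nat_widen _ _ _ xpredT) //.
rewrite -{1}[nat_of_ord j]add0n big_addn big_mkord subSn //.
transitivity ((-1) ^+ (i + j) * 'C(d - j, i - j)%:R * (1 - 1) ^+ (i - j) : K).
  rewrite exprBn mulr_sumr; apply: eq_bigr => t _.
  have -> : (i + (t + j) = i + j + t)%N by lia.
  by rewrite addnK !expr1n !mulr1 natrM exprD -mulr_natr; ring.
rewrite subrr expr0n subn_eq0; case: (leqP i j) => ij.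
  have /val_inj-> : val i = val j by apply/eqP; rewrite eqn_leq ij.
  by rewrite subnn bin0 eqxx -signr_odd addnn odd_double !mulr1.
by rewrite mulr0 -val_eqE gtn_eqF.
Qed.

Lemma invmx_Hmx (K : numFieldType) (d : nat) : invmx (Hmx K d) = Hmx_inv K d.
Proof.
have e := Hmx_mul_inv K d; have [u _] := mulmx1_unit e.
by rewrite -[LHS]mulmx1 -e mulmxA mulVmx // mul1mx.
Qed.

(* Main.v *)
Require Import Defs.
From mathcomp Require Import all_boot all_order all_algebra.
From mathcomp Require Import zify.
Import GRing.Theory Num.Theory.
Local Open Scope ring_scope.

(** Row [k >= 1] of the matrix [F] is an iterated finite difference: the entry
    in column [l] is the [(k-1)]-st difference with step 2, taken at 2, of the
    polynomial [x^l - (x-1)^l].  That polynomial is 0 for [l = 0] and otherwise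
    has degree [l-1] and leading coefficient [l], and each difference with step
    [h] lowers the degree by one while multiplying the leading coefficient by
    [h] times the old degree.  So the entry vanishes for [l < k] and equals [2^(k-1) k!] for [l = k]
    ([iterated_fwd_diff], [Fmx_entry]).

    Row and column 0 of [F] are both the first unit vector.  Hence [F] is the
    direct sum of the [1 x 1] identity and an upper triangular core of size [d]
    ([Fmx_block]), whose diagonal [1, 2 2!, ..., 2^(d-1) d!] is strictly
    increasing.  The core has a split characteristic polynomial with simple
    roots, so it is diagonalizable, and then so is [F].  Splitting off the first
    coordinate is what makes this work: the double eigenvalue 1 of [F] is shared
    between the two summands, each of which carries it only once.

    For a diagonalizable matrix both multiplicities of a scalar count its
    occurrences on the diagonal ([diagonalizable_multiplicity]), so they can be
    read off the characteristic polynomial.  Finally, [R] is by construction a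
    conjugate of [F], and conjugation preserves diagonalizability and the
    characteristic polynomial. *)

(** * Finite differences of polynomials *)

Definition fwd_diff {R : comNzRingType} (h : R) (p : {poly R}) : {poly R} :=
  p \Po ('X + h%:P) - p.

Lemma horner_fwd_diff {R : comNzRingType} (h : R) (p : {poly R}) (x : R) :
  (fwd_diff h p).[x] = p.[x + h] - p.[x].
Proof. by rewrite hornerD hornerN horner_comp hornerD hornerX hornerC. Qed.

Lemma coef_XaddC_exp {R : comNzRingType} (h : R) (m i : nat) :
  (('X + h%:P) ^+ m)`_i = h ^+ (m - i) *+ 'C(m, i).
Proof.
elim: m i => [|m IHm] [|i].
- by rewrite !expr0 coef1 bin0.
- by rewrite expr0 coef1 bin0n mulr0n.
- by rewrite exprS mulrDl coefD coefXM coefCM IHm !bin0 !subn0 exprS add0r.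
rewrite exprS mulrDl coefD coefXM coefCM !IHm binS mulrnDr subSS addrC.
congr (_ + _); rewrite /= mulrnAr -exprS.
have [im | mi] := ltnP i m; first by rewrite subnSK.
by rewrite bin_small.
Qed.

(** Above degree [n-2] only one coefficient of the difference of a polynomial of
    degree at most [n] can survive: the terms of degree [n] cancel, and the
    subleading term of [(X + h)^n] contributes [n h] in degree [n-1]. *)
Lemma coef_fwd_diff {R : comNzRingType} (h : R) (n i : nat) (p : {poly R}) :
  (size p <= n.+1)%N -> (n <= i.+1)%N ->
  (fwd_diff h p)`_i = if n == i.+1 then h * p`_n *+ n else 0.
Proof.
move=> sp ni; rewrite coefB coef_comp_poly.
rewrite (big_ord_widen _ (fun j => p`_j * (('X + h%:P) ^+ j)`_i) sp).
rewrite big_mkcond /=.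
transitivity (\sum_(j < n.+1) p`_j * h ^+ (j - i) *+ 'C(j, i) - p`_i).
  congr (_ - _); apply: eq_bigr => j _; rewrite coef_XaddC_exp mulrnAr.
  by case: ltnP => // sj; rewrite nth_default ?mul0r ?mul0rn.
case: eqP => [-> | neq]; last first.
  have {neq}ni : (n <= i)%N by lia.
  rewrite big_ord_recr big1 /= => [|j _]; last first.
    by rewrite bin_small ?mulr0n //; apply: leq_trans ni.
  case: (eqVneq n i) => [-> | ne].
    by rewrite subnn binn mulr1 add0r subrr.
  rewrite bin_small; last by lia.
  by rewrite mulr0n add0r sub0r nth_default ?oppr0 // (leq_trans sp) //; lia.
rewrite !big_ord_recr big1 /= => [|j _]; last by rewrite bin_small ?mulr0n.
by rewrite subnn binn subSnn binSn add0r mulr1 addrAC subrr add0r mulrC.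
Qed.

Lemma size_fwd_diff {R : comNzRingType} (h : R) (n : nat) (p : {poly R}) :
  (size p <= n.+1)%N -> (size (fwd_diff h p) <= n)%N.
Proof.
move=> sp; apply/leq_sizeP => i ni.
by rewrite (coef_fwd_diff _ _ _ _ sp) ?(leqW ni) // ltn_eqF.
Qed.

(** Pascal's rule in operator form: the [(n+1)]-st difference of a sequence is
    the [n]-th difference of its first difference. *)
Lemma sum_signed_binS {R : pzRingType} (n : nat) (u : nat -> R) :
  \sum_(j < n.+2) (-1) ^+ j * 'C(n.+1, j)%:R * u (n.+1 - j)%N =
  \sum_(j < n.+1) (-1) ^+ j * 'C(n, j)%:R * (u (n - j).+1 - u (n - j)%N).
Proof.
under [RHS]eq_bigr do rewrite mulrBr.
rewrite sumrB [LHS]big_ord_recl [X in _ = X - _]big_ord_recl /=.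
rewrite !bin0 !subn0 -addrA; congr (_ + _).
transitivity (\sum_(j < n.+1) (-1) ^+ j.+1 * 'C(n, j.+1)%:R * u (n - j)%N
   - \sum_(j < n.+1) (-1) ^+ j * 'C(n, j)%:R * u (n - j)%N).
  rewrite -sumrB; apply: eq_bigr => j _; rewrite /bump /= add1n subSS binS.
  by rewrite natrD mulrDr mulrDl exprS mulN1r !mulNr.
congr (_ - _); rewrite big_ord_recr /= bin_small // mulr0 mul0r addr0.
by apply: eq_bigr => j _; rewrite /bump /= add1n subnSK.
Qed.

(** The bound on the size makes the [n]-th difference a constant polynomial, which
    is why the value does not depend on [x]. *)
Lemma iterated_fwd_diff {R : comNzRingType} (h x : R) (n : nat) (p : {poly R}) :
  (size p <= n.+1)%N ->
  \sum_(j < n.+1) (-1) ^+ j * 'C(n, j)%:R * p.[x + (n - j)%:R * h] =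
  p`_n * h ^+ n *+ n`!.
Proof.
elim: n p => [|n IHn] p sp.
  rewrite big_ord1 bin0 mul0r addr0 !mul1r mulr1.
  by rewrite [p in p.[x]]size1_polyC // hornerC.
rewrite (sum_signed_binS n (fun i => p.[x + i%:R * h])).
transitivity (\sum_(j < n.+1) (-1) ^+ j * 'C(n, j)%:R *
    (fwd_diff h p).[x + (n - j)%:R * h]).
  apply: eq_bigr => j _; rewrite horner_fwd_diff.
  by rewrite -natr1 mulrDl mul1r addrA.
rewrite IHn ?size_fwd_diff // (coef_fwd_diff _ _ _ _ sp) // eqxx factS.
by rewrite mulrnAl -mulrnA exprS mulrCA mulrA.
Qed.

(** * The entries of the transformation matrix *)

(** The sum defining the entry is an iterated difference with step 2 and base
    point 2, because [2k - 2j = 2 + 2 (k-1-j)]. *)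
Lemma Fmx_entry (K : numFieldType) (d : nat) (k l : 'I_d.+1) :
  (0 < k)%N -> (l <= k)%N ->
  Fmx K d k l = if l == k then (2 ^ k.-1 * k`!)%:R else 0.
Proof.
case: k => [[//|n] kd] _ lk; rewrite mxE /=.
have sX : (size ('X^l : {poly K}) <= l.+1)%N by rewrite size_polyXn.
(* The bracket x^l - (x-1)^l is itself a difference, with step -1, so its degree
   and leading coefficient come from the same lemma. *)
pose g := - fwd_diff (-1) ('X^l : {poly K}).
have gE x : g.[x] = x ^+ l - (x - 1) ^+ l.
  by rewrite hornerN horner_fwd_diff !hornerXn opprB.
have sg : (size g <= n.+1)%N.
  by rewrite size_polyN; apply: leq_trans lk; apply: size_fwd_diff.
transitivity (\sum_(j < n.+1) (-1) ^+ j * 'C(n, j)%:R *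
    g.[2%:R + (n - j)%:R * 2%:R]).
  apply: eq_bigr => -[j jn] _ /=; rewrite gE -natrM -natrD addSnnS.
  have -> : (2 * n.+1 - 2 * j = 1 + ((n - j) * 2).+1)%N by lia.
  by rewrite add1n subn1 /= -natr1 addrK.
rewrite iterated_fwd_diff // /g coefN (coef_fwd_diff _ _ _ _ sX) //.
rewrite -val_eqE /=; case: eqP => [-> | _]; last by rewrite oppr0 !mul0r mul0rn.
rewrite coefXn eqxx mulr1 mulNrn opprK factS.
by rewrite !natrM natrX -[LHS]mulr_natr -mulrA [RHS]mulrCA.
Qed.

Lemma Fmx_row0 (K : numFieldType) (d : nat) (l : 'I_d.+1) :
  Fmx K d ord0 l = (l == ord0)%:R.
Proof. by rewrite mxE eqxx. Qed.

Lemma Fmx_col0 (K : numFieldType) (d : nat) (k : 'I_d.+1) :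
  Fmx K d k ord0 = (k == ord0)%:R.
Proof.
case: (eqVneq k ord0) => [-> | k0]; first by rewrite Fmx_row0.
by rewrite Fmx_entry ?lt0n // eq_sym (negPf k0).
Qed.

(** * Diagonalizable matrices *)

Lemma char_poly_tr {R : comNzRingType} {n : nat} (A : 'M[R]_n) :
  char_poly A^T = char_poly A.
Proof.
by rewrite /char_poly -[RHS]det_tr; congr (\det _);
   rewrite /char_poly_mx linearB /= tr_scalar_mx map_trmx.
Qed.

Lemma char_poly_block {R : comNzRingType} {m n : nat} (A : 'M[R]_m) (B : 'M[R]_n) :
  char_poly (block_mx A 0 0 B) = char_poly A * char_poly B.
Proof. by rewrite /char_poly char_block_diag_mx det_ublock. Qed.

Lemma char_poly_conj {F : fieldType} {n : nat} (P A : 'M[F]_n) :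
  P \in unitmx -> char_poly (P *m A *m invmx P) = char_poly A.
Proof.
move=> uP; rewrite /char_poly.
have -> : char_poly_mx (P *m A *m invmx P) =
    map_mx polyC P *m char_poly_mx A *m map_mx polyC (invmx P).
  rewrite /char_poly_mx !map_mxM mulmxBr mulmxBl; congr (_ - _).
  by rewrite scalar_mxC -mulmxA -map_mxM mulmxV // map_mx1 mulmx1.
by rewrite !det_mulmx mulrAC -det_mulmx -map_mxM mulmxV // map_mx1 det1 mul1r.
Qed.

Lemma mxrank_conj {F : fieldType} {n : nat} (P A : 'M[F]_n) :
  P \in unitmx -> \rank (P *m A *m invmx P) = \rank A.
Proof.
move=> uP; rewrite mxrankMfree ?row_free_unit ?unitmx_inv //.
by rewrite eqmxMfull // row_full_unit.
Qed.

Lemma mxrank_diag {F : fieldType} {n : nat} (D : 'rV[F]_n) :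
  \rank (diag_mx D) = (\sum_(i < n) (D 0 i != 0)%R)%N.
Proof.
elim: n D => [|n IHn] D; first by rewrite big_ord0 [diag_mx D]flatmx0 mxrank0.
set a := lsubmx (D : 'rV_(1 + n)); set b := rsubmx (D : 'rV_(1 + n)).
have Dab : D = row_mx a b by rewrite hsubmxK.
have -> : \rank (diag_mx D) = (\rank (diag_mx a) + \rank (diag_mx b))%N.
  by rewrite -rank_diag_block_mx -diag_mx_row -Dab.
rewrite IHn big_ord_recl; congr (_ + _)%N.
  have -> : diag_mx a = (D 0 ord0)%:M.
    apply/matrixP => i j; rewrite !ord1 [LHS]mxE [RHS]mxE Dab.
    by rewrite -(row_mxEl a b); congr (row_mx _ _ _ _ *+ _); apply: val_inj.
  rewrite rank_rV; congr (nat_of_bool (~~ _)).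
  apply/eqP/eqP => [/matrixP/(_ ord0 ord0) | ->]; rewrite ?mxE ?eqxx //.
  by apply/matrixP => i j; rewrite !mxE mul0rn.
apply: eq_bigr => i _; rewrite Dab -(row_mxEr a b).
by congr (nat_of_bool (row_mx _ _ _ _ != _)); apply: val_inj.
Qed.

Lemma char_poly_diag {F : fieldType} {n : nat} (D : 'rV[F]_n) :
  char_poly (diag_mx D) = \prod_(x <- [seq D 0 i | i <- enum 'I_n]) ('X - x%:P).
Proof.
rewrite char_poly_trig ?diag_mx_is_trig // big_map big_enum /=.
by apply: eq_bigr => i _; rewrite mxE eqxx.
Qed.

(** In a diagonalizing basis the matrix is [diag_mx D]: the characteristic
    polynomial counts the [i] with [D 0 i = a], and the rank of [A - a] counts
    the others. *)
Lemma diagonalizable_multiplicity {F : fieldType} {n : nat} (A : 'M[F]_n) (a : F) :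
  diagonalizable A -> has_multiplicity A a (mup a (char_poly A)).
Proof.
case=> P uP /similar_diagPex[D /(similarRL uP) AD]; split=> //.
rewrite -(char_poly_conj P A uP) -AD char_poly_diag mu_prod_XsubC count_map.
rewrite mxrank_ker.
have -> : \rank (A - a%:M) = \rank (diag_mx (D - const_mx a)).
  rewrite -(mxrank_conj P (A - _) uP) mulmxBr mulmxBl -AD scalar_mxC mulmxK //.
  by rewrite linearB /= diag_const_mx.
rewrite mxrank_diag -sum1_count big_enum_cond /=.
rewrite -[X in (X - _)%N]card_ord -sum1_card -sumnB => [|i _]; last exact: leq_b1.
rewrite [RHS]big_mkcond; apply: eq_big => //= i _.
by rewrite !mxE subr_eq0; case: eqP.
Qed.

(** By Cayley-Hamilton the minimal polynomial divides a product of distinct linear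
    factors. *)
Lemma diagonalizable_uniq_char_poly {F : fieldType} {n : nat} (A : 'M[F]_n.+1)
    (s : seq F) :
  uniq s -> char_poly A = \prod_(x <- s) ('X - x%:P) -> diagonalizable A.
Proof.
move=> us cA; apply/diagonalizableP; exists s => //.
by rewrite -cA mxminpoly_dvd_char.
Qed.

Lemma diagonalizable_block {F : fieldType} {m n : nat} (A : 'M[F]_m) (B : 'M[F]_n) :
  diagonalizable A -> diagonalizable B -> diagonalizable (block_mx A 0 0 B).
Proof.
case=> P uP /similar_diagPex[D /(similarP uP) AD].
case=> Q uQ /similar_diagPex[E /(similarP uQ) BE].
have uPQ : block_mx P 0 0 Q \in unitmx by rewrite block_diag_mx_unit uP.
exists (block_mx P 0 0 Q) => //; apply/similar_diagPex; exists (row_mx D E).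
apply/similarP => //; rewrite diag_mx_row !mulmx_block.
by rewrite !mulmx0 !mul0mx !addr0 !add0r AD BE.
Qed.

Lemma diagonalizable_conj {F : fieldType} {n : nat} (P A : 'M[F]_n) :
  P \in unitmx -> diagonalizable A -> diagonalizable (P *m A *m invmx P).
Proof.
move=> uP [Q uQ /similar_diagPex[D /(similarP uQ) AD]].
have uQP : Q *m invmx P \in unitmx by rewrite unitmx_mul uQ unitmx_inv.
exists (Q *m invmx P) => //; apply/similar_diagPex; exists D.
by apply/similarP => //; rewrite !mulmxA mulmxKV // AD.
Qed.

(** * Diagonalizing the transformation matrix *)

(** The diagonal of the core of [F], so that 1 occurs here only once; the shift
    [k = n + 1] makes the list start at [n = 0]. *)
Definition Fmx_eigenvalues (K : numFieldType) (d : nat) : seq K :=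
  [seq (2 ^ n * n.+1`!)%:R | n <- iota 0 d].

Lemma Fmx_eigenvalues_uniq (K : numFieldType) (d : nat) :
  uniq (Fmx_eigenvalues K d).
Proof.
rewrite map_inj_uniq ?iota_uniq // => m n /eqP; rewrite eqr_nat => /eqP.
apply: (incn_inj (f := fun n => 2 ^ n * n.+1`!)%N) => {m n}.
apply: leq_mono; apply: homo_ltn ltn_trans _ => k.
(* Consecutive values have ratio 2 (k + 2). *)
rewrite expnS [X in (_ < _ * X)%N]factS.
have k0 : (0 < 2 ^ k * k.+1`!)%N by rewrite muln_gt0 expn_gt0 fact_gt0.
nia.
Qed.

Lemma mem1_Fmx_eigenvalues (K : numFieldType) (d : nat) :
  (0 < d)%N -> 1 \in Fmx_eigenvalues K d.
Proof. by case: d => // d _; rewrite inE mulr1n eqxx. Qed.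

Lemma mem_Fmx_eigenvalues (K : numFieldType) (d k : nat) :
  (2 <= k <= d)%N -> (2 ^ (k - 1) * k`!)%:R \in Fmx_eigenvalues K d.
Proof.
case: k => // k kd; rewrite subn1; apply/mapP; exists k => //.
by rewrite mem_iota; lia.
Qed.

Lemma Fmx_eigenvaluesP (K : numFieldType) (d : nat) (a : K) :
  a \in Fmx_eigenvalues K d ->
  a = 1 \/ exists k : nat, (2 <= k <= d)%N /\ a = (2 ^ (k - 1) * k`!)%:R.
Proof.
case/mapP => -[|n]; rewrite mem_iota => /= nd ->; first by left.
by right; exists n.+2; rewrite subn1.
Qed.

Definition Fmx_core (K : numFieldType) (d : nat) : 'M[K]_d :=
  drsubmx (Fmx K d : 'M_(1 + d)).

Lemma Fmx_block (K : numFieldType) (d : nat) :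
  Fmx K d = block_mx 1%:M 0 0 (Fmx_core K d) :> 'M_(1 + d).
Proof.
have l0 (i : 'I_1) : lshift d i = ord0 by apply: val_inj; rewrite /= ord1.
have r0 (i : 'I_d) : (rshift 1 i == ord0) = false by [].
apply/matrixP => i j.
case: (split_ordP i) => i' ->; case: (split_ordP j) => j' ->.
- by rewrite block_mxEul !ord1 !mxE.
- by rewrite block_mxEur l0 Fmx_row0 r0 mxE.
- by rewrite block_mxEdl l0 Fmx_col0 r0 mxE.
by rewrite block_mxEdr !mxE.
Qed.

(** The core is upper triangular, while [is_trig_mx] means lower triangular; hence
    the passage to the transpose. *)
Lemma char_poly_Fmx_core (K : numFieldType) (d : nat) :
  char_poly (Fmx_core K d) = \prod_(x <- Fmx_eigenvalues K d) ('X - x%:P).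
Proof.
have coreE (i j : 'I_d) : (j <= i)%N ->
    Fmx_core K d i j = if j == i then (2 ^ i * i.+1`!)%:R else 0.
  by move=> ji; rewrite 2!mxE Fmx_entry //.
rewrite -char_poly_tr char_poly_trig.
  have -> : Fmx_eigenvalues K d =
      [seq (2 ^ n * n.+1`!)%:R | n <- index_iota 0 d] by rewrite /index_iota subn0.
  rewrite big_map big_mkord.
  by apply: eq_bigr => i _; rewrite mxE coreE ?eqxx.
by apply/is_trig_mxP => i j ij; rewrite mxE coreE ?(ltnW ij) // -val_eqE ltn_eqF.
Qed.

Lemma char_poly_Fmx (K : numFieldType) (d : nat) :
  char_poly (Fmx K d) = \prod_(x <- 1 :: Fmx_eigenvalues K d) ('X - x%:P).
Proof.
rewrite Fmx_block.
transitivity (char_poly (1%:M : 'M[K]_1) * char_poly (Fmx_core K d)).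
exact: (@char_poly_block K 1 d 1%:M (Fmx_core K d)).
rewrite big_cons char_poly_Fmx_core; congr (_ * _).
by rewrite char_poly_trig ?scalar_mx_is_trig // big_ord1 mxE.
Qed.

Lemma diagonalizable_Fmx (K : numFieldType) (d : nat) :
  (0 < d)%N -> diagonalizable (Fmx K d).
Proof.
case: d => // d _; rewrite Fmx_block.
apply: (@diagonalizable_block K 1 d.+1); first exact: diagonalizable_scalar.
apply: diagonalizable_uniq_char_poly (char_poly_Fmx_core K d.+1).
exact: Fmx_eigenvalues_uniq.
Qed.

Lemma Hmx_unit (K : numFieldType) (d : nat) : Hmx K d \in unitmx.
Proof. by have [] := mulmx1_unit (Hmx_mul_inv K d). Qed.

Theorem lemma3p7 (K : numFieldType) (d : nat) (hd : (1 <= d)%N) :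
  similar_in unitmx (Fmx K d) (Rmx K d)
  /\
  (forall A : 'M[K]_d.+1, A = Fmx K d \/ A = Rmx K d ->
     diagonalizable A
     /\ (forall a : K, eigenvalue A a <->
           a = 1 \/ exists k : nat, (2 <= k <= d)%N /\ a = (2 ^ (k - 1) * k`!)%:R)
     /\ has_multiplicity A 1 2
     /\ (forall k : nat, (2 <= k <= d)%N ->
           has_multiplicity A (2 ^ (k - 1) * k`!)%:R 1)).
Proof.
have uH := Hmx_unit K d; have us := Fmx_eigenvalues_uniq K d.
have s1 := mem1_Fmx_eigenvalues K d hd.
split; first by exists (Hmx K d) => //; apply/(similarRL uH).
move=> A AFR; have [dA cA] : diagonalizable A /\
    char_poly A = \prod_(x <- 1 :: Fmx_eigenvalues K d) ('X - x%:P).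
  have dF := diagonalizable_Fmx K d hd.
  case: AFR => ->; first by split=> //; apply: char_poly_Fmx.
  by split; [apply: diagonalizable_conj | rewrite char_poly_conj // char_poly_Fmx].
(* The first summand comes from row 0, the second from the core. *)
have multA a : has_multiplicity A a ((1 == a)%R + (a \in Fmx_eigenvalues K d))%N.
  have := diagonalizable_multiplicity A a dA.
  by rewrite cA mu_prod_XsubC /= count_uniq_mem.
split=> //; split.
  move=> a; rewrite eigenvalue_root_char cA root_prod_XsubC inE; split.
    by case/orP => [/eqP -> | /Fmx_eigenvaluesP //]; left.
  case=> [-> | [k [kd ->]]]; first by rewrite eqxx.
  by rewrite mem_Fmx_eigenvalues // orbT.
split; first by have := multA 1; rewrite eqxx s1.
move=> k kd; have := multA (2 ^ (k - 1) * k`!)%:R.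
rewrite mem_Fmx_eigenvalues // eq_sym pnatr_eq1.
suff -> : ((2 ^ (k - 1) * k`!)%N == 1%N) = false by [].
case/andP: kd => k2 _.
rewrite muln_eq1 -[k in k`!](subnK k2) addn2 factS.
have := fact_gt0 (k - 2).+1; nia.
Qed.
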